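(* Let $\Gamma=(\mathsf{V},\mathsf{D},s,t)$ be a locally finite connected directed graph endowed with edge-weights $x=(x_e)_{e\in\mathsf{D}}\in\mathbb{C}^{\mathsf{D}}$, and let $p\colon\widetilde{\Gamma}\to\Gamma$ be a covering map of finite degree $d$, with $\widetilde{\Gamma}=(\widetilde{\mathsf{V}},\widetilde{\mathsf{D}},s,t)$ connected. Endow $\widetilde{\Gamma}$ with the lifted weights $\tilde{x}_{\tilde e}:=x_{p(\tilde e)}$ for $\tilde e\in\widetilde{\mathsf{D}}$. Fix $v_0\in\mathsf{V}$ and $\tilde v_0\in p^{-1}(v_0)$, and regard $\pi_1(\widetilde{\Gamma},\tilde v_0)$ as a subgroup of index $d$ of $\pi_1(\Gamma,v_0)$ via the injective homomorphism $p_*$. Let $\rho\colon\pi_1(\widetilde{\Gamma},\tilde v_0)\to\operatorname{GL}(W)$ be a representation on a finite-dimensional complex vector space $W$, and let $\rho^\#\colon\pi_1(\Gamma,v_0)\to\operatorname{GL}(Z)$ be the induced representation. Then there is an isomorphism $\psi\colon W^{\widetilde{\mathsf{V}}}\to Z^{\mathsf{V}}$ such that $\psi\circ\mathsf{A}^{\rho}_{\widetilde{\Gamma}}=\mathsf{A}^{\rho^\#}_{\Gamma}\circ\psi$.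
   Context: A directed graph $\Gamma=(\mathsf{V},\mathsf{D},s,t)$ consists of a vertex set $\mathsf{V}$, an edge set $\mathsf{D}$ and source/target maps $s,t\colon\mathsf{D}\to\mathsf{V}$ (loops and multiple edges allowed). It is locally finite if $\mathsf{D}_v=\{e\in\mathsf{D}: s(e)=v\}$ and $\mathsf{D}^v=\{e\in\mathsf{D}: t(e)=v\}$ are finite for every $v$, and connected if any two vertices are joined by a directed path. The fundamental group $\pi_1(\Gamma,v)$ of a directed graph is defined by first formally adding an inverse edge $\bar e$ (with $s(\bar e)=t(e)$, $t(\bar e)=s(e)$) for each $e\in\mathsf{D}$, and then taking the group of loops based at $v$ (finite sequences of edges $(e_1,\dots,e_n)$ with $t(e_i)=s(e_{i+1})$, starting and ending at $v$) modulo homotopy, i.e. modulo insertion/removal of consecutive pairs $(e,\bar e)$, with concatenation as product. A morphism of directed graphs $p\colon\widetilde\Gamma\to\Gamma$ is a pair of maps on vertices and edges commuting with $s$ and $t$; it is a covering map if it is surjective on vertices and for every vertex $\tilde v$ it restricts to bijections $\widetilde{\mathsf{D}}_{\tilde v}\to\mathsf{D}_{p(\tilde v)}$ and $\widetilde{\mathsf{D}}^{\tilde v}\to\mathsf{D}^{p(\tilde v)}$; its degree is the common cardinality of the fibers. A covering map induces an injective homomorphism $p_*$ on fundamental groups (extend $p$ to inverse edges). Twisted operator: for a representation $\rho\colon\pi_1(\Gamma,v_0)\to\operatorname{GL}(W)$, a connection is a family $(\varphi_e)$ of automorphisms of $W$ indexed by the edges $e$ and their inverses, with $\varphi_{\bar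 e}=\varphi_e^{-1}$, viewed as maps from the copy of $W$ at $t(e)$ to the copy at $s(e)$; it represents $\rho$ if the monodromy $[(e_1,\dots,e_n)]\mapsto\varphi_{e_1}\circ\cdots\circ\varphi_{e_n}$ of loops based at $v_0$ equals $\rho$ (every representation is represented by some connection, and different choices give conjugate operators below). The twisted weighted adjacency operator on $W^{\mathsf{V}}$ is $(\mathsf{A}^\rho_\Gamma f)(v)=\sum_{e\in\mathsf{D}_v}x_e\,\varphi_e(f(t(e)))$, well defined up to conjugation by an automorphism of $W^{\mathsf{V}}$. Induced representation: for $H<G$ of finite index with set of coset representatives $R$ of $G/H$ and $\rho\colon H\to\operatorname{GL}(W)$, $\rho^\#\colon G\to\operatorname{GL}(Z)$ is the (unique up to isomorphism) representation with $Z=\bigoplus_{r\in R}\rho^\#_r(W)$ and $\rho^\#_g(\rho^\#_r(w))=\rho^\#_{r'}(\rho_h(w))$ whenever $gr=r'h$ with $r'\in R$, $h\in H$. *)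

(* Defs.v *)
From HB Require Import structures.
From Stdlib Require Import Relation_Operators Operators_Properties.
From mathcomp Require Import all_boot all_order all_algebra.
From mathcomp Require Import boolp classical_sets functions cardinality fsbigop.
From mathcomp Require Import reals complex.

Set Implicit Arguments.
Unset Strict Implicit.
Unset Printing Implicit Defensive.

Import GRing.Theory.

Local Open Scope classical_set_scope.
Local Open Scope quotient_scope.
Local Open Scope group_scope.

Record digraph := Digraph {
  vertex : choiceType;
  edge : choiceType;
  src : edge -> vertex;
  tgt : edge -> vertex
}.

Arguments src {d}.
Arguments tgt {d}.

Definition out_edges (G : digraph) (v : vertex G) : set (edge G) :=
  [set e | src e = v].

Definition in_edges (G : digraph) (v : vertex G) : set (edge G) :=
  [set e | tgt e = v].

Definition locally_finite (G : digraph) : Prop :=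
  forall v : vertex G, finite_set (out_edges v) /\ finite_set (in_edges v).

(** An oriented edge [inl e] is the edge [e] itself, and [inr e] is its formal
    inverse, which differs from every edge even when [e] is a loop. *)
Definition oedge (G : digraph) : Type := (edge G + edge G)%type.

Definition osrc (G : digraph) (e : oedge G) : vertex G :=
  match e with inl e => src e | inr e => tgt e end.

Definition otgt (G : digraph) (e : oedge G) : vertex G :=
  match e with inl e => tgt e | inr e => src e end.

Definition obar (G : digraph) (e : oedge G) : oedge G :=
  match e with inl e => inr e | inr e => inl e end.

Fixpoint walk (G : digraph) (u : vertex G) (s : seq (oedge G)) (v : vertex G)
    : bool :=
  match s with
  | [::] => u == v
  | e :: s' => (osrc e == u) && walk (otgt e) s' v
  end.

(** Directed paths use no inverse edges; the empty path joins [u] to [u]. *)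
Definition dconnected (G : digraph) : Prop :=
  forall u v : vertex G, exists s : seq (edge G), walk u (map inl s) v.

Section Walks.
Variable G : digraph.
Implicit Types (u v w : vertex G) (s : seq (oedge G)) (e : oedge G).

Lemma obarK : involutive (@obar G). Proof. by case. Qed.

Lemma osrc_bar e : osrc (obar e) = otgt e. Proof. by case: e. Qed.

Lemma otgt_bar e : otgt (obar e) = osrc e. Proof. by case: e. Qed.

Lemma walk_cat u v w s1 s2 : walk u s1 v -> walk v s2 w -> walk u (s1 ++ s2) w.
Proof.
elim: s1 u => [|e s1 IH] u /=; first by move/eqP->.
by move=> /andP[-> /IH]; apply.
Qed.

Lemma walk_rev u v s : walk u s v -> walk v (rev (map (@obar G) s)) u.
Proof.
elim: s u => [|e s IH] u /=; first by rewrite eq_sym.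
move=> /andP[/eqP <- /IH h]; rewrite rev_cons -cats1.
by apply: walk_cat h _; rewrite /= osrc_bar otgt_bar !eqxx.
Qed.

End Walks.

Definition loop (G : digraph) (v : vertex G) : Type :=
  {s : seq (oedge G) | walk v s v}.

Section FundamentalGroup.
Variables (G : digraph) (v : vertex G).
Implicit Types a b c : loop v.

(** [b] arises from [a] by inserting a pair [(e, obar e)], where [e] is an edge
    or an inverse edge. *)
Definition insertion a b : Prop :=
  exists s1 s2 e, val a = s1 ++ s2 /\ val b = s1 ++ [:: e; obar e] ++ s2.

Definition homotopic a b : Prop := clos_refl_sym_trans (loop v) insertion a b.

Definition homotopicb a b : bool := `[< homotopic a b >].

Lemma homotopicb_refl : reflexive homotopicb.
Proof. by move=> a; apply/asboolP/rst_refl. Qed.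

Lemma homotopicb_sym : symmetric homotopicb.
Proof. by move=> a b; apply/asboolP/asboolP; apply: rst_sym. Qed.

Lemma homotopicb_trans : transitive homotopicb.
Proof.
by move=> b a c /asboolP ab /asboolP bc; apply/asboolP; apply: rst_trans ab bc.
Qed.

Canonical homotopy_equiv :=
  EquivRel homotopicb homotopicb_refl homotopicb_sym homotopicb_trans.

Definition pi1 : Type := {eq_quot homotopicb}.

HB.instance Definition _ := Choice.on pi1.
HB.instance Definition _ := EqQuotient.on pi1.

Definition loop1 : loop v := exist _ [::] (eqxx v).

Definition loopM a b : loop v :=
  exist _ (val a ++ val b) (walk_cat (valP a) (valP b)).

Definition loopV a : loop v :=
  exist _ (rev (map (@obar G) (val a))) (walk_rev (valP a)).

Lemma homotopicM a a' b b' :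
  homotopic a a' -> homotopic b b' -> homotopic (loopM a b) (loopM a' b').
Proof.
move=> haa' hbb'; apply: (rst_trans _ _ _ (loopM a' b)).
  elim: haa' => {a a'} [a a' [s1 [s2 [e [E E']]]]|a|a a' _|a a' a'' _ + _].
  - by apply: rst_step; exists s1, (s2 ++ val b), e; rewrite /= E E' -!catA.
  - exact: rst_refl.
  - exact: rst_sym.
  - exact: rst_trans.
elim: hbb' => {b b'} [b b' [s1 [s2 [e [E E']]]]|b|b b' _|b b' b'' _ + _].
- by apply: rst_step; exists (val a' ++ s1), s2, e; rewrite /= E E' -!catA.
- exact: rst_refl.
- exact: rst_sym.
- exact: rst_trans.
Qed.

Lemma homotopicV a a' : homotopic a a' -> homotopic (loopV a) (loopV a').
Proof.
elim=> {a a'} [a a' [s1 [s2 [e [E E']]]]|a|a a' _|a a' a'' _ + _].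
- apply: rst_step.
  exists (rev (map (@obar G) s2)), (rev (map (@obar G) s1)), e.
  rewrite /= E E' !map_cat !rev_cat /= obarK; split=> //.
  by rewrite -!catA.
- exact: rst_refl.
- exact: rst_sym.
- exact: rst_trans.
Qed.

Lemma loopMV a : homotopic (loopM a (loopV a)) loop1.
Proof.
suff H n : forall c, val c = take n (val a) ++ rev (map (@obar G) (take n (val a)))
    -> homotopic c loop1.
  by apply: (H (size (val a))); rewrite take_size.
elim: n => [|n IH] c Ec.
  by have -> : c = loop1 by [apply: val_inj; rewrite Ec take0]; apply: rst_refl.
have [nlt|nge] := ltnP n (size (val a)); last first.
  by apply: IH; rewrite Ec !take_oversize // ltnW.
case: (val a) nlt IH Ec => // e0 s nlt IH Ec.
rewrite (take_nth e0 nlt) map_rcons rev_rcons cat_rcons in Ec.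
set t := take n _ in IH Ec; set e := nth _ _ _ in Ec.
have wt : walk v (t ++ rev (map (@obar G) t)) v.
  have := valP c; rewrite Ec.
  have wE u s1 s2 w : walk u (s1 ++ s2) w -> exists2 z, walk u s1 z & walk z s2 w.
    elim: s1 u => [|f s1 IH1] u /=; first by move=> ?; exists u.
    by case/andP=> -> /IH1 [z ? ?]; exists z.
  move=> /wE [z w1 w2]; apply: walk_cat w1 _.
  by case/and3P: w2 => /eqP <- _; rewrite otgt_bar.
pose c' : loop v := exist (fun s => walk v s v) _ wt.
apply: (rst_trans _ _ _ c' _ _ (IH c' erefl)); apply/rst_sym/rst_step.
by exists t, (rev (map (@obar G) t)), e; split => //=; rewrite Ec.
Qed.

Lemma loopVK : involutive loopV.
Proof.
move=> a; apply: val_inj; rewrite /= map_rev revK -map_comp.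
by rewrite (eq_map (@obarK G)) map_id.
Qed.

Definition pi1_class (a : loop v) : pi1 := \pi_pi1 a.

Definition pi1_one : pi1 := pi1_class loop1.

Definition pi1_mul (x y : pi1) : pi1 := pi1_class (loopM (repr x) (repr y)).

Definition pi1_inv (x : pi1) : pi1 := pi1_class (loopV (repr x)).

Lemma pi1_classP a b : reflect (homotopic a b) (pi1_class a == pi1_class b).
Proof.
rewrite /pi1_class; apply: (iffP eqP).
  by move/eqmodP => /asboolP.
by move=> h; apply/eqmodP/asboolP.
Qed.

Lemma pi1_eq a b : homotopic a b -> pi1_class a = pi1_class b.
Proof. by move/pi1_classP/eqP. Qed.

Lemma repr_class a : homotopic (repr (pi1_class a)) a.
Proof. by apply/pi1_classP/eqP; rewrite /pi1_class reprK. Qed.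

Lemma classM a b : pi1_mul (pi1_class a) (pi1_class b) = pi1_class (loopM a b).
Proof. by apply/pi1_eq/homotopicM; apply: repr_class. Qed.

Lemma classV a : pi1_inv (pi1_class a) = pi1_class (loopV a).
Proof. by apply/pi1_eq/homotopicV/repr_class. Qed.

Lemma pi1_classE (x : pi1) : exists a, x = pi1_class a.
Proof. by exists (repr x); rewrite /pi1_class reprK. Qed.

Lemma pi1_mulA : associative pi1_mul.
Proof.
move=> x y z; have [a ->] := pi1_classE x; have [b ->] := pi1_classE y.
have [c ->] := pi1_classE z; rewrite !classM; congr pi1_class.
by apply: val_inj; rewrite /= catA.
Qed.

Lemma pi1_mul1 : left_id pi1_one pi1_mul.
Proof.
move=> x; have [a ->] := pi1_classE x; rewrite classM; congr pi1_class.
exact: val_inj.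
Qed.

Lemma pi1_mulr1 : right_id pi1_one pi1_mul.
Proof.
move=> x; have [a ->] := pi1_classE x; rewrite classM; congr pi1_class.
by apply: val_inj; rewrite /= cats0.
Qed.

Lemma pi1_mulrV : right_inverse pi1_one pi1_inv pi1_mul.
Proof.
move=> x; have [a ->] := pi1_classE x; rewrite classV classM.
exact/pi1_eq/loopMV.
Qed.

Lemma pi1_mulV : left_inverse pi1_one pi1_inv pi1_mul.
Proof.
move=> x; have [a ->] := pi1_classE x; rewrite classV classM.
by apply/pi1_eq; rewrite -[X in loopM _ X]loopVK; apply: loopMV.
Qed.

HB.instance Definition _ := isGroup.Build pi1
  pi1_mulA pi1_mul1 pi1_mulr1 pi1_mulV pi1_mulrV.

Lemma pi1_class1 : pi1_class loop1 = 1 :> pi1.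
Proof. by []. Qed.

Lemma pi1_classM a b : pi1_class (loopM a b) = pi1_class a * pi1_class b.
Proof. by rewrite -classM. Qed.

Lemma pi1_classV a : pi1_class (loopV a) = (pi1_class a)^-1.
Proof. by rewrite -classV. Qed.

End FundamentalGroup.

Record dgmorphism (G1 G2 : digraph) := DGMorphism {
  mor_v :> vertex G1 -> vertex G2;
  mor_e : edge G1 -> edge G2;
  mor_src : forall e, src (mor_e e) = mor_v (src e);
  mor_tgt : forall e, tgt (mor_e e) = mor_v (tgt e)
}.

Definition covering (G1 G2 : digraph) (p : dgmorphism G1 G2) : Prop :=
  [/\ forall v : vertex G2, exists u : vertex G1, p u = v,
      forall u : vertex G1, set_bij (out_edges u) (out_edges (p u)) (mor_e p)
    & forall u : vertex G1, set_bij (in_edges u) (in_edges (p u)) (mor_e p)].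

Definition has_degree (G1 G2 : digraph) (p : dgmorphism G1 G2) (d : nat)
    : Prop :=
  forall v : vertex G2, ([set u | p u = v] #= `I_d)%card.

Section InducedMorphism.
Variables (G1 G2 : digraph) (p : dgmorphism G1 G2).

Definition mor_oe (e : oedge G1) : oedge G2 :=
  match e with inl e => inl (mor_e p e) | inr e => inr (mor_e p e) end.

Lemma mor_oe_bar e : mor_oe (obar e) = obar (mor_oe e).
Proof. by case: e. Qed.

Lemma walk_map u s w : walk u s w -> walk (p u) (map mor_oe s) (p w).
Proof.
elim: s u => [|e s IH] u /=; first by move/eqP->.
case/andP=> /eqP <- /IH; case: e => e /=.
  by rewrite mor_src mor_tgt eqxx.
by rewrite mor_src mor_tgt eqxx.
Qed.

Variables (u : vertex G1) (v : vertex G2) (puv : p u = v).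

Lemma walk_map_loop (a : loop u) : walk v (map mor_oe (val a)) v.
Proof. by rewrite -puv; apply: walk_map (valP a). Qed.

Definition loop_map (a : loop u) : loop v :=
  exist _ (map mor_oe (val a)) (walk_map_loop a).

Definition pi1_map (x : pi1 u) : pi1 v := pi1_class (loop_map (repr x)).

Lemma homotopic_map a b :
  homotopic a b -> homotopic (loop_map a) (loop_map b).
Proof.
elim=> {a b} [a b [s1 [s2 [e [E E']]]]|a|a b _|a b c _ + _].
- apply: rst_step; exists (map mor_oe s1), (map mor_oe s2), (mor_oe e).
  by rewrite /= E E' !map_cat /= mor_oe_bar.
- exact: rst_refl.
- exact: rst_sym.
- exact: rst_trans.
Qed.

Lemma pi1_map_class a : pi1_map (pi1_class a) = pi1_class (loop_map a).
Proof. exact/pi1_eq/homotopic_map/repr_class. Qed.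

Lemma pi1_mapM : {morph pi1_map : x y / x * y}.
Proof.
move=> x y; have [a ->] := pi1_classE x; have [b ->] := pi1_classE y.
rewrite -pi1_classM !pi1_map_class -pi1_classM; congr pi1_class.
by apply: val_inj; rewrite /= map_cat.
Qed.

HB.instance Definition _ := isMultiplicative.Build (pi1 u) (pi1 v) pi1_map
  pi1_mapM.

End InducedMorphism.

Section GeneralLinearGroup.
Variables (K : fieldType) (W : vectType K).

Record GL := MkGL { glval :> 'End(W); glvalP : lker glval == 0%VS }.

HB.instance Definition _ := [isSub for glval].
HB.instance Definition _ := [Choice of GL by <:].

Lemma GL1_subproof : lker (\1%VF : 'End(W)) == 0%VS.
Proof. by apply/lker0P => x y; rewrite !id_lfunE. Qed.

Lemma GLM_subproof (f g : GL) : lker (glval f \o glval g)%VF == 0%VS.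
Proof.
by apply/lker0P => x y; rewrite !comp_lfunE => /(lker0P (glvalP f));
  apply: (lker0P (glvalP g)).
Qed.

Lemma GLV_subproof (f : GL) : lker (glval f)^-1%VF == 0%VS.
Proof. by apply/lker0P; apply: can_inj (lker0_lfunVK (glvalP f)). Qed.

Definition GL1 := MkGL GL1_subproof.

Definition GLM f g := MkGL (GLM_subproof f g).

Definition GLV f := MkGL (GLV_subproof f).

Lemma GLMA : associative GLM.
Proof. by move=> f g h; apply/val_inj; rewrite /= comp_lfunA. Qed.

Lemma GLM1l : left_id GL1 GLM.
Proof. by move=> f; apply/val_inj; rewrite /= comp_lfun1l. Qed.

Lemma GLM1r : right_id GL1 GLM.
Proof. by move=> f; apply/val_inj; rewrite /= comp_lfun1r. Qed.

Lemma GLMVl : left_inverse GL1 GLV GLM.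
Proof.
by move=> f; apply/val_inj; rewrite /= lker0_compVf ?glvalP.
Qed.

Lemma GLMVr : right_inverse GL1 GLV GLM.
Proof.
by move=> f; apply/val_inj; rewrite /= lker0_compfV ?glvalP.
Qed.

HB.instance Definition _ := isGroup.Build GL GLMA GLM1l GLM1r GLMVl GLMVr.

End GeneralLinearGroup.

(** The subgroup is the image of [iota], and [r] enumerates one representative
    of each of its left cosets. *)
Definition coset_reps (G H : groupType) (iota : H -> G) (I : finType)
    (r : I -> G) : Prop :=
  forall g : G, exists! i : I, exists h : H, g = r i * iota h.

(** [rhoS] is a model of the representation induced from [rho] along the
    inclusion [iota] of a subgroup with left coset representatives [r]; the map
    [j] identifies [W] with a subspace of [Z], so that [Z] is the direct sum of
    the translates of [W] by the [rhoS (r i)]. *)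
Definition induced_rep (K : fieldType) (G H : groupType) (iota : H -> G)
    (I : finType) (r : I -> G) (W Z : vectType K)
    (rho : {multiplicative H -> GL W}) (rhoS : {multiplicative G -> GL Z})
    : Prop :=
  exists j : 'Hom(W, Z),
    [/\ lker j == 0%VS,
        directv (\sum_(i : I) (rhoS (r i) @: limg j))%VS,
        (\sum_(i : I) (rhoS (r i) @: limg j))%VS = fullv
      & forall (g : G) (i i' : I) (h : H) (w : W), g * r i = r i' * iota h ->
          rhoS g (rhoS (r i) (j w)) = rhoS (r i') (j (rho h w))].

(** [conn e] goes from the copy of [W] at [otgt e] to the copy at [osrc e]. *)
Record connection (K : fieldType) (G : digraph) (W : vectType K) := Connection {
  conn :> oedge G -> GL W;
  conn_bar : forall e, conn (obar e) = (conn e)^-1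
}.

Definition monodromy (K : fieldType) (G : digraph) (W : vectType K)
    (phi : connection G W) (v : vertex G) (a : loop v) : GL W :=
  \prod_(e <- val a) phi e.

Definition represents (K : fieldType) (G : digraph) (W : vectType K)
    (v : vertex G) (phi : connection G W)
    (rho : {multiplicative pi1 v -> GL W}) : Prop :=
  forall a : loop v, rho (pi1_class a) = monodromy phi a.

Definition twisted_adj (K : fieldType) (G : digraph) (W : vectType K)
    (x : edge G -> K) (phi : connection G W) (f : vertex G -> W)
    : vertex G -> W :=
  fun v => (\sum_(e \in out_edges v) x e *: phi (inl e) (f (tgt e)))%R.

(* Main.v *)
(** Let [j : W -> Z] be the embedding defining the induced representation.
    Transporting a fibre of [W] at a vertex [u] along a path [q] to the base
    point, embedding by [j], and transporting back along the image of [q] gives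
    a map [T u : W -> Z]. As [j] is equivariant for [pi1 vt0], [T u] does not
    depend on [q], so [T] commutes with the connections along every edge. The
    isomorphism is [(psi f) v = sum of T u (f u) over u above v]. It intertwines
    the operators since an edge [e] lifts uniquely from each point above its
    source and to each point above its target. It is bijective since, lifting
    the inverses of the coset representatives [r i] continued by a fixed path to
    [v], one reaches every point above [v] once, and [T] at that point is
    [rhoS (r i) \o j] up to automorphisms of [W] and of [Z], the latter
    independent of [i]. *)

From HB Require Import structures.
Require Import Defs.
From mathcomp Require Import all_boot all_order all_algebra.
From mathcomp Require Import boolp classical_sets functions cardinality fsbigop.
From mathcomp Require Import reals complex.

(** * Path lifting, holonomy, and transport of [W] into [Z] along walks *)

Section Transfer.
Set Implicit Arguments.
Unset Strict Implicit.
Local Open Scope group_scope.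

Lemma walk_catP (G : digraph) (u w : vertex G) (s1 s2 : seq (oedge G)) :
  walk u (s1 ++ s2) w -> exists2 v, walk u s1 v & walk v s2 w.
Proof.
elim: s1 u => [|e s1 IH] u /=; first by exists u.
by case/andP=> -> /IH[v]; exists v.
Qed.

(** The last edge of [c] meets its inverse in the middle of the backtrack; deleting this pair is one
    elementary homotopy, and induction on [c] from its end removes the rest. *)
Lemma homotopic_backtrack (G : digraph) (v : vertex G)
    (s1 c s2 : seq (oedge G)) (a b : loop v) :
  val a = s1 ++ (c ++ rev (map (@obar G) c)) ++ s2 -> val b = s1 ++ s2 ->
  homotopic a b.
Proof.
elim/last_ind: c a => [|c e IH] a Ea Eb.
  have -> : a = b by apply: val_inj; rewrite Ea Eb.
  exact: Relation_Operators.rst_refl.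
rewrite map_rcons rev_rcons -cats1 -!catA in Ea.
(* The shortened word must first be seen to be a loop: the deleted pair starts and ends at the same
   vertex. *)
have wa : walk v (s1 ++ (c ++ rev (map (@obar G) c)) ++ s2) v.
  have wa : walk v (val a) v := valP a.
  move: wa; rewrite Ea catA => /walk_catP[z w1] /= /and3P[/eqP ez _].
  rewrite otgt_bar ez => w2.
  by rewrite -!catA [X in walk _ X]catA; apply: walk_cat w1 w2.
have := IH (exist (fun s => walk v s v) _ wa) erefl Eb.
apply: Relation_Operators.rst_trans.
apply/Relation_Operators.rst_sym/Relation_Operators.rst_step.
exists (s1 ++ c), (rev (map (@obar G) c) ++ s2), e.
by split; [rewrite /= -!catA | rewrite Ea -!catA].
Qed.

(** Edges are lifted one at a time, through the bijection on outgoing edges for an edge and on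
    incoming edges for an inverse edge. *)
Lemma covering_lift_walk (Gt G : digraph) (p : dgmorphism Gt G) (u : vertex Gt)
    (w : vertex G) (s : seq (oedge G)) :
  covering p -> walk (p u) s w ->
  exists u' (st : seq (oedge Gt)),
    [/\ walk u st u', map (mor_oe p) st = s & p u' = w].
Proof.
move=> [_ bout bin]; elim: s u => [|e s IH] u /=.
  by move=> /eqP <-; exists u, [::]; split=> /=.
case/andP=> /eqP eu.
have [et [<- <-]] : exists et, mor_oe p et = e /\ osrc et = u.
  case: e eu => e eu.
    by have [_ _ /(_ e eu)[et /= etu <-]] := bout u; exists (inl et).
  by have [_ _ /(_ e eu)[et /= etu <-]] := bin u; exists (inr et).
have -> : otgt (mor_oe p et) = p (otgt et).
  by case: (et) => ? /=; rewrite ?mor_src ?mor_tgt.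
case/IH=> u' [st [wst <- pu']]; exists u', (et :: st); split=> //=.
by rewrite eqxx.
Qed.

Definition holonomy (K : fieldType) (G : digraph) (W : vectType K)
    (phi : connection G W) (s : seq (oedge G)) : GL W :=
  \prod_(e <- s) phi e.

Lemma holonomy_cat (K : fieldType) (G : digraph) (W : vectType K)
    (phi : connection G W) (s1 s2 : seq (oedge G)) :
  holonomy phi (s1 ++ s2) = holonomy phi s1 * holonomy phi s2.
Proof. exact: big_cat. Qed.

Lemma holonomy_rev (K : fieldType) (G : digraph) (W : vectType K)
    (phi : connection G W) (s : seq (oedge G)) :
  holonomy phi (rev (map (@obar G) s)) = (holonomy phi s)^-1.
Proof.
elim: s => [|e s IH]; first by rewrite /holonomy !big_nil invg1.
rewrite /= rev_cons -cats1 holonomy_cat IH /holonomy big_seq1 big_cons.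
by rewrite conn_bar -invgM.
Qed.

Lemma GLM_apply (K : fieldType) (W : vectType K) (f g : GL W) (w : W) :
  glval (f * g) w = glval f (glval g w).
Proof. exact: comp_lfunE. Qed.

Lemma GL1_apply (K : fieldType) (W : vectType K) (w : W) :
  glval (1 : GL W) w = w.
Proof. exact: id_lfunE. Qed.

Lemma GLVK (K : fieldType) (W : vectType K) (f : GL W) :
  cancel (glval f) (glval f^-1).
Proof. by move=> w; rewrite -GLM_apply mulVg GL1_apply. Qed.

Lemma GLKV (K : fieldType) (W : vectType K) (f : GL W) :
  cancel (glval f^-1) (glval f).
Proof. by move=> w; rewrite -GLM_apply mulgV GL1_apply. Qed.

Lemma multiplicativeV (G H : groupType) (f : {multiplicative G -> H}) (x : G) :
  f x^-1 = (f x)^-1.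
Proof.
have f1 : f 1 = 1 by apply: (mulgI (f 1)); rewrite -gmulfM !mulg1.
by apply: (mulgI (f x)); rewrite mulgV -gmulfM mulgV.
Qed.

(** Equivariance of [j], where 1 need not be a coset representative: the induction formula at the
    conjugate of [iota h] by any [r i] yields it after cancelling [rhoS (r i)]. *)
Lemma induced_rep_sub (K : fieldType) (G H : groupType) (iota : H -> G)
    (I : finType) (r : I -> G) (W Z : vectType K)
    (rho : {multiplicative H -> GL W}) (rhoS : {multiplicative G -> GL Z})
    (j : 'Hom(W, Z)) :
  coset_reps iota r ->
  (forall (g : G) (i i' : I) (h : H) (w : W), g * r i = r i' * iota h ->
     rhoS g (rhoS (r i) (j w)) = rhoS (r i') (j (rho h w))) ->
  forall h w, rhoS (iota h) (j w) = j (rho h w).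
Proof.
move=> cr ind h w; have [i _] := cr 1.
have := ind (r i * iota h * (r i)^-1) i i h w.
rewrite mulgVK => /(_ erefl) e.
apply: (can_inj (GLVK (rhoS (r i)))); rewrite -e.
by rewrite -!GLM_apply -!gmulfM mulgVK.
Qed.

(** For a walk [q] from [vt0] to [u] this is [T u] computed along [q]. Connections act from target
    to source, so the holonomy of [q] goes from [u] back to [vt0]. *)
Definition transfer (K : fieldType) (Gt G : digraph) (p : dgmorphism Gt G)
    (W Z : vectType K) (j : 'Hom(W, Z)) (phi : connection Gt W)
    (phiS : connection G Z) (q : seq (oedge Gt)) : 'Hom(W, Z) :=
  (glval (holonomy phiS (map (mor_oe p) q))^-1%g \o j
     \o glval (holonomy phi q))%VF.

Lemma transferE (K : fieldType) (Gt G : digraph) (p : dgmorphism Gt G)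
    (W Z : vectType K) (j : 'Hom(W, Z)) (phi : connection Gt W)
    (phiS : connection G Z) (q : seq (oedge Gt)) (w : W) :
  transfer p j phi phiS q w =
  glval (holonomy phiS (map (mor_oe p) q))^-1 (j (glval (holonomy phi q) w)).
Proof. by rewrite /transfer !comp_lfunE. Qed.

(** The image of [e] contributes the leftmost factor of the inverse holonomy, which
    [phiS (mor_oe p e)] cancels. *)
Lemma transfer_edge (K : fieldType) (Gt G : digraph) (p : dgmorphism Gt G)
    (W Z : vectType K) (j : 'Hom(W, Z)) (phi : connection Gt W)
    (phiS : connection G Z) (q : seq (oedge Gt)) (e : oedge Gt) (w : W) :
  phiS (mor_oe p e) (transfer p j phi phiS (rcons q e) w) =
  transfer p j phi phiS q (phi e w).
Proof.
rewrite !transferE map_rcons -!cats1 !holonomy_cat invgM !GLM_apply.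
by rewrite /holonomy !big_seq1 GLKV.
Qed.

(** The walk [q] followed by the reverse of [q'] is a loop at [vt0], and [j] is equivariant under
    its class. *)
Lemma transfer_homotopy (K : fieldType) (Gt G : digraph) (p : dgmorphism Gt G)
    (v0 : vertex G) (vt0 : vertex Gt) (pv0 : p vt0 = v0) (W Z : vectType K)
    (rho : {multiplicative pi1 vt0 -> GL W})
    (rhoS : {multiplicative pi1 v0 -> GL Z}) (j : 'Hom(W, Z))
    (phi : connection Gt W) (phiS : connection G Z) :
  (forall h w, rhoS (pi1_map pv0 h) (j w) = j (rho h w)) ->
  represents phi rho -> represents phiS rhoS ->
  forall (u : vertex Gt) (q q' : seq (oedge Gt)),
    walk vt0 q u -> walk vt0 q' u ->
    transfer p j phi phiS q = transfer p j phi phiS q'.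
Proof.
move=> sub rep repS u q q' wq wq'; apply/lfunP => w; rewrite !transferE.
pose a : loop vt0 :=
  exist (fun s => walk vt0 s vt0) _ (walk_cat wq (walk_rev wq')).
(* The vector is chosen so that the holonomy of the reversed [q'] cancels against it. *)
have := sub (pi1_class a) (glval (holonomy phi q') w).
rewrite pi1_map_class rep repS.
rewrite -[monodromy phi a]/(holonomy phi _) /=.
rewrite -[monodromy phiS _]/(holonomy phiS _) /= map_cat.
have -> : map (mor_oe p) (rev (map (@obar Gt) q')) =
    rev (map (@obar G) (map (mor_oe p) q')).
  rewrite map_rev -!map_comp; congr rev.
  by apply: eq_map => e; apply: mor_oe_bar.
rewrite !holonomy_cat !holonomy_rev !GLM_apply GLVK => <-.
by rewrite GLVK.
Qed.

Lemma fiber_frame (K : fieldType) (Gt G : digraph) (p : dgmorphism Gt G)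
    (d : nat) (v0 : vertex G) (vt0 : vertex Gt) (pv0 : p vt0 = v0)
    (W Z : vectType K) (rhoS : {multiplicative pi1 v0 -> GL Z})
    (r : 'I_d -> pi1 v0) (j : 'Hom(W, Z)) (phi : connection Gt W)
    (phiS : connection G Z) (T : vertex Gt -> 'Hom(W, Z)) (v : vertex G) :
  dconnected Gt -> covering p -> has_degree p d ->
  coset_reps (pi1_map pv0) r -> represents phiS rhoS ->
  (forall u q, walk vt0 q u -> T u = transfer p j phi phiS q) ->
  exists (u : 'I_d -> vertex Gt) (A : GL Z) (B : 'I_d -> GL W),
    [/\ forall i, p (u i) = v, injective u,
        forall ut, p ut = v -> exists i, u i = ut
      & forall i w, T (u i) w = A (rhoS (r i) (j (B i w)))].
Proof.
move=> conn cov deg cr repS TE.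
have [c wc] : exists c, walk v0 c v.
  have [psurj _ _] := cov; have [ut <-] := psurj v.
  have [q wq] := conn vt0 ut; exists (map (mor_oe p) (map inl q)).
  by rewrite -pv0; apply: walk_map.
pose b i : loop v0 := loopV (repr (r i)).
have bE i : pi1_class (b i) = (r i)^-1.
  by rewrite pi1_classV /pi1_class reprK.
have /choice[u /choice[q uq]] i : exists u q,
    [/\ walk vt0 q u, map (mor_oe p) q = val (b i) ++ c & p u = v].
  apply: covering_lift_walk cov _; rewrite pv0.
  exact: walk_cat (valP (b i)) wc.
(* Two lifts with a common end form a loop whose image has class [(r i)^-1 * r i'], so [r i] and
   [r i'] share a left coset; hence the inverses in [b]. *)
have injU : injective u.
  move=> i i' eu; have [w1 e1 _] := uq i; have [w2 e2 _] := uq i'.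
  rewrite -eu in w2.
  pose a : loop vt0 :=
    exist (fun s => walk vt0 s vt0) _ (walk_cat w1 (walk_rev w2)).
  have ha : pi1_map pv0 (pi1_class a) = (r i)^-1 * r i'.
    rewrite pi1_map_class -bE -[r i']invgK -bE -pi1_classV -pi1_classM.
    apply: pi1_eq.
    apply: (@homotopic_backtrack _ _ (val (b i)) c (val (loopV (b i')))) => //=.
    rewrite map_cat e1 map_rev -map_comp.
    rewrite (eq_map (mor_oe_bar p)) (map_comp (@obar G)) e2 map_cat rev_cat.
    by rewrite -!catA.
  have [k [_ kU]] := cr (r i').
  rewrite -(kU i); last by exists (pi1_class a); rewrite ha mulgA mulgV mul1g.
  apply: kU; exists (pi1_class (loop1 vt0)); rewrite pi1_map_class.
  have -> : loop_map pv0 (loop1 vt0) = loop1 v0 by apply: val_inj.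
  by rewrite pi1_class1 mulg1.
(* Since [q i] lies over [b i] followed by [c], the inverse holonomy of its image is that of [c]
   times [rhoS (r i)]. *)
exists u, (holonomy phiS c)^-1, (fun i => holonomy phi (q i)).
split=> // [i|ut put|i w]; first by have [] := uq i.
- (* An injection of ['I_d] into a fibre of cardinality [d] is onto, which
     spares a proof of unique path lifting. *)
  have /card_set_bijP[k [kfun kinj _]] := deg v.
  have pu i : p (u i) = v by have [] := uq i.
  pose f (i : 'I_d) : 'I_d := Ordinal (kfun (u i) (pu i)).
  have finj : injective f.
    move=> i i' /(congr1 val) /= e; apply: injU.
    by apply: kinj e; rewrite inE /=.
  have /codomP[i /(congr1 val) /= e] := injF_onto finj (Ordinal (kfun ut put)).
  by exists i; apply: kinj (esym e); rewrite inE /=.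
have [wq eq _] := uq i.
rewrite (TE _ _ wq) transferE eq holonomy_cat invgM GLM_apply.
congr (glval _ _); rewrite -[holonomy phiS _]/(monodromy phiS (b i)) -repS bE.
by rewrite multiplicativeV invgK.
Qed.

End Transfer.

(** * Sums over fibres: linearity, bijectivity and intertwining *)

Section FiberSum.
Set Implicit Arguments.
Unset Strict Implicit.
Import GRing.Theory.
Local Open Scope classical_set_scope.
Local Open Scope ring_scope.

(** This is [psi] once [u y] enumerates the fibre above [y]. *)
Definition fiber_sum (K : fieldType) (W Z : vectType K) (X Y : Type)
    (I : finType) (u : Y -> I -> X) (T : X -> 'Hom(W, Z)) (f : X -> W) (y : Y) :
    Z :=
  \sum_i T (u y i) (f (u y i)).

Lemma fiber_sum_linear (K : fieldType) (W Z : vectType K) (X Y : Type)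
    (I : finType) (u : Y -> I -> X) (T : X -> 'Hom(W, Z)) :
  linear (fiber_sum u T : (X -> W) -> (Y -> Z)).
Proof.
move=> a f g; apply/funext => y; rewrite /fiber_sum.
rewrite [RHS](_ : _ = a *: \sum_i T (u y i) (f (u y i)) +
  \sum_i T (u y i) (g (u y i))) // scaler_sumr -big_split.
by apply: eq_bigr => i _ /=; rewrite -linearP.
Qed.

HB.instance Definition _ (K : fieldType) (W Z : vectType K) (X Y : Type)
    (I : finType) (u : Y -> I -> X) (T : X -> 'Hom(W, Z)) :=
  GRing.isLinear.Build K (X -> W) (Y -> Z) _ (fiber_sum u T)
    (fiber_sum_linear u T).

(** Components in a direct sum are unique, and so are their preimages under the injective [g i]. *)
Lemma directv_sum_bij (K : fieldType) (W Z : vectType K) (I : finType)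
    (U : I -> {vspace Z}) (g : I -> 'Hom(W, Z)) :
  (forall i, lker (g i) == 0%VS) -> (forall i, U i = limg (g i)) ->
  directv (\sum_i U i) -> (\sum_i U i)%VS = fullv ->
  forall z, exists! w : {ffun I -> W}, \sum_i g i (w i) = z.
Proof.
move=> kg Ug dU fU z.
have /memv_sumP[zs zsP ->] : z \in (\sum_i U i)%VS by rewrite fU memvf.
have /choice[w wP] i : exists w, zs i = g i w.
  by have := zsP i isT; rewrite Ug => /memv_imgP[w _ ->]; exists w.
exists [ffun i => w i]; split.
  by apply: eq_bigr => i _; rewrite ffunE -wP.
move=> w' /eqP; rewrite (directv_sum_unique dU) => [/forallP e|i _|//].
  apply/ffunP => i; rewrite ffunE; apply: (lker0P (kg i)).
  by rewrite -wP (eqP (implyP (e i) isT)).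
by rewrite Ug memv_img ?memvf.
Qed.

(** Automorphisms preserve unique solvability: solve for [A^-1 z], then undo each [B i]. *)
Lemma directv_sum_twist_bij (K : fieldType) (W Z : vectType K) (I : finType)
    (j : 'Hom(W, Z)) (g : I -> GL Z) (h : I -> 'Hom(W, Z)) (A : GL Z)
    (B : I -> GL W) :
  lker j == 0%VS -> directv (\sum_i (g i @: limg j)) ->
  (\sum_i (g i @: limg j))%VS = fullv ->
  (forall i w, h i w = A (g i (j (B i w)))) ->
  forall z, exists! w : {ffun I -> W}, \sum_i h i (w i) = z.
Proof.
move=> kj dg fg hE z.
have gjE i : (g i @: limg j)%VS = limg (g i \o j)%VF by rewrite limg_comp.
have kgj i : lker (g i \o j)%VF == 0%VS.
  apply/lker0P => w w'; rewrite !comp_lfunE => /(lker0P (glvalP (g i))).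
  exact: (lker0P kj).
have hsum (w : {ffun I -> W}) :
    \sum_i h i (w i) = A (\sum_i (g i \o j)%VF ([ffun i => B i (w i)] i)).
  by rewrite linear_sum; apply: eq_bigr => i _; rewrite hE ffunE comp_lfunE.
have [w [wz wU]] := directv_sum_bij kgj gjE dg fg (glval A^-1%g z).
exists [ffun i => glval (B i)^-1%g (w i)]; split.
  rewrite hsum -[RHS](GLKV A) -wz; congr (glval A _); apply: eq_bigr => i _.
  by rewrite !ffunE GLKV.
move=> w'; rewrite hsum => Aw'; have := wU [ffun i => B i (w' i)].
by rewrite -Aw' GLVK => /(_ erefl) ->; apply/ffunP => i; rewrite !ffunE GLVK.
Qed.

(** The fibres partition [X], so the map is block diagonal, with one bijective block for each
    [y]. *)
Lemma fiber_sum_bij (K : fieldType) (W Z : vectType K) (X Y : Type)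
    (I : finType) (p : X -> Y) (u : Y -> I -> X) (T : X -> 'Hom(W, Z)) :
  (forall y i, p (u y i) = y) -> (forall y, injective (u y)) ->
  (forall x, exists i, u (p x) i = x) ->
  (forall y z, exists! w : {ffun I -> W}, \sum_i T (u y i) (w i) = z) ->
  bijective (fiber_sum u T).
Proof.
move=> pu uI us bT.
have /choice[k kP] := us.
have ku y i : k (u y i) = i by apply: (uI y); rewrite -{1}(pu y i) kP.
have /choice[s sP] (yz : Y * Z) : exists w : {ffun I -> W},
    \sum_i T (u yz.1 i) (w i) = yz.2.
  by have [w [wP _]] := bT yz.1 yz.2; exists w.
(* The inverse solves the block of [p x] and reads off the entry at [k x], the index of [x] in its
   fibre. *)
exists (fun h x => s (p x, h (p x)) (k x)) => [f|h].
  apply/funext => x; have [w [_ wU]] := bT (p x) (fiber_sum u T f (p x)).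
  rewrite -(wU _ (sP (_, _))) (wU [ffun i => f (u (p x) i)]).
    by rewrite ffunE kP.
  by apply: eq_bigr => i _; rewrite ffunE.
apply/funext => y; rewrite /fiber_sum -[RHS](sP (y, h y)).
by apply: eq_bigr => i _; rewrite pu ku.
Qed.

Lemma set_bij_finite (A B : Type) (X : set A) (Y : set B) (f : A -> B) :
  set_bij X Y f -> finite_set Y -> finite_set X.
Proof.
move=> [fX fI _]; rewrite -(eq_finite_set (inj_card_eq fI)).
by apply: sub_finite_set => _ [a Xa <-]; apply: fX.
Qed.

(** At [v], both sides become double sums over [I] and the edges out of [v]. For a fixed edge, the
    targets of its lifts run once through the fibre above its target. *)
Lemma fiber_sum_twisted_adj (K : fieldType) (Gt G : digraph)
    (p : dgmorphism Gt G) (W Z : vectType K) (I : finType)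
    (x : edge G -> K) (phi : connection Gt W) (phiS : connection G Z)
    (u : vertex G -> I -> vertex Gt) (T : vertex Gt -> 'Hom(W, Z)) :
  locally_finite G -> covering p ->
  (forall v i, p (u v i) = v) -> (forall v, injective (u v)) ->
  (forall ut, exists i, u (p ut) i = ut) ->
  (forall e w,
     phiS (inl (mor_e p e)) (T (tgt e) w) = T (src e) (phi (inl e) w)) ->
  fiber_sum u T \o twisted_adj (x \o mor_e p) phi =
  twisted_adj x phiS \o fiber_sum u T.
Proof.
move=> lf [_ bout bin] pu uI us Tedge; apply/funext => f; apply/funext => v /=.
have [fin _] := lf v.
have /choice[k kP] := us.
(* [s (i, e)] is the index of the target of the lift of [e] starting at
   [u v i]; it is arbitrary when [e] does not start at [v]. *)
have /choice[s sP] (ie : I * edge G) : exists i', src ie.2 = v -> exists et,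
    [/\ mor_e p et = ie.2, src et = u v ie.1 & tgt et = u (tgt ie.2) i'].
  case: ie => i e /=; have [_ _ sj] := bout (u v i); rewrite pu in sj.
  have [ev|nev] := pselect (src e = v); last by exists i.
  have [et /= es <-] := sj e ev; exists (k (tgt et)) => _; exists et.
  by rewrite mor_tgt kP.
(* The contribution of the lift of [e] from [u v i], with the connection moved across [T] by
   [Tedge]. *)
pose F i e := x e *: glval (phiS (inl e))
  (T (u (tgt e) (s (i, e))) (f (u (tgt e) (s (i, e))))).
transitivity (\sum_i \sum_(e \in out_edges v) F i e).
  apply: eq_bigr => i _; have := bout (u v i); rewrite pu => bi.
  rewrite (reindex_fsbig _ _ _ _ bi) /twisted_adj.
  have fini : finite_set (out_edges (u v i)).
    by apply: set_bij_finite bi (lf v).1.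
  rewrite !fsbig_finite // linear_sum; apply: eq_big_seq => e.
  rewrite in_fset_set // inE /= => es.
  have ev : src (mor_e p e) = v by rewrite mor_src es pu.
  have [et /= [ee es' et']] := sP (i, mor_e p e) ev.
  have [_ inj _] := bi.
  have ete : et = e by apply: inj => //; rewrite inE /= ?es.
  by rewrite /F -et' ete Tedge es linearZ.
rewrite /twisted_adj; under eq_bigr do rewrite fsbig_finite //.
rewrite fsbig_finite // exchange_big; apply: eq_big_seq => e.
rewrite in_fset_set // inE /= => ev.
(* Lifts of [e] with the same target coincide, hence have the same source. An injective self-map of
   the finite [I] is then a permutation. *)
have sI : injective (fun i => s (i, e)).
  move=> i i' ei; have [et /= [e1 s1 t1]] := sP (i, e) ev.
  have [et' /= [e2 s2 t2]] := sP (i', e) ev.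
  have [_ inj _] := bin (tgt et).
  have eet : et = et'.
    apply: inj; rewrite ?e1 ?e2 // inE //.
    by rewrite /in_edges /= t1 t2 ei.
  by apply: (uI v); rewrite -s1 -s2 eet.
rewrite /F -scaler_sumr -linear_sum /fiber_sum; congr (_ *: glval _ _).
by rewrite [RHS](reindex _ (onW_bij _ (injF_bij sI))).
Qed.

End FiberSum.

Theorem theorem3p6 (R : realType) (Gt G : digraph) (x : edge G -> R[i])
    (p : dgmorphism Gt G) (d : nat) (v0 : vertex G) (vt0 : vertex Gt)
    (pv0 : p vt0 = v0) (W Z : vectType R[i])
    (rho : {multiplicative pi1 vt0 -> GL W})
    (rhoS : {multiplicative pi1 v0 -> GL Z}) (r : 'I_d -> pi1 v0)
    (phi : connection Gt W) (phiS : connection G Z) :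
  locally_finite G -> dconnected G -> dconnected Gt ->
  covering p -> has_degree p d ->
  coset_reps (pi1_map pv0) r -> induced_rep (pi1_map pv0) r rho rhoS ->
  represents phi rho -> represents phiS rhoS ->
  exists psi : {linear (vertex Gt -> W) -> (vertex G -> Z)},
    bijective psi /\
    psi \o twisted_adj (x \o mor_e p) phi = twisted_adj x phiS \o psi.
Proof.
move=> lf _ conn cov deg cr [j [jker jdir jfull ind]] rep repS.
have indep := transfer_homotopy (induced_rep_sub cr ind) rep repS.
have /choice[q wq] : forall ut, exists q, walk vt0 q ut.
  by move=> ut; have [q wq] := conn vt0 ut; exists (map inl q).
pose T ut := transfer p j phi phiS (q ut).
have TE ut q' : walk vt0 q' ut -> T ut = transfer p j phi phiS q'.
  by move=> w; apply: indep (wq ut) w.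
have /choice[u uP] := fun v => fiber_frame v conn cov deg cr repS TE.
have pu v i : p (u v i) = v by have [A [B []]] := uP v.
have uI v : injective (u v) by have [A [B []]] := uP v.
have us ut : exists i, u (p ut) i = ut.
  by have [A [B [_ _ h _]]] := uP (p ut); apply: h.
exists (fiber_sum u T); split; last first.
  apply: fiber_sum_twisted_adj => // e w.
  (* [T] at [tgt e] may be computed along the walk chosen for [src e] extended by [e]. *)
  have we : walk vt0 (rcons (q (src e)) (inl e)) (tgt e).
    by rewrite -cats1; apply: walk_cat (wq _) _; rewrite /= !eqxx.
  by rewrite (TE _ _ we) (transfer_edge p j phi phiS (q (src e)) (inl e) w).
apply: (fiber_sum_bij pu uI us) => v z.
have [A [B [_ _ _ ABE]]] := uP v.
exact: (directv_sum_twist_bij jker jdir jfull ABE).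
Qed.
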